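(* Let $f,g:[a;b]\to\mathbb{R}$ be two regulated functions which have no common points of discontinuity. Let $\eta_0\ge\eta_1\ge\ldots$ and $\theta_0\ge\theta_1\ge\ldots$ be two sequences of non-negative numbers such that $\eta_k\downarrow0$ and $\theta_k\downarrow0$ as $k\to+\infty$. Define $\theta_{-1}:=\sup_{a\le t\le b}|g(b)-g(t)|$ and \[ \tilde S:=\sum_{k=0}^{+\infty}2^{k}\theta_{k-1}\cdot TV(f,[a;b],\eta_k)+\sum_{k=0}^{+\infty}2^{k}\eta_k\cdot TV(g,[a;b],\theta_k). \] If $\tilde S<+\infty$, then the Riemann–Stieltjes integral $\int_a^b f\,\mathrm{d}g$ exists and \[ \left|\int_a^b f\,\mathrm{d}g-f(a)\left[g(b)-g(a)\right]\right|\le \tilde S. \]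
   Context: A function $h:[a;b]\to\mathbb{R}$ is regulated if the one-sided finite limits $\lim_{t\to a+}h(t)$, $\lim_{t\to b-}h(t)$ exist and, for every $x\in(a;b)$, both finite limits $\lim_{t\to x-}h(t)$ and $\lim_{t\to x+}h(t)$ exist. The total variation is $TV(h,[a;b],0)=\sup_n\sup_{a\le t_1<\dots<t_n\le b}\sum_{i=2}^{n}|h(t_i)-h(t_{i-1})|$. For $\delta\ge0$, the truncated variation is $TV(h,[a;b],\delta):=\inf\{TV(u,[a;b],0):\sup_{a\le t\le b}|h(t)-u(t)|\le\delta/2\}$; for regulated $h$ and $\delta>0$ it equals $\sup_n\sup_{a\le t_1<\dots<t_n\le b}\sum_{i=2}^{n}\max\{|h(t_i)-h(t_{i-1})|-\delta,0\}$. The Riemann–Stieltjes integral $\int_a^b f\,\mathrm{d}g$ exists if the sums $\sum_i f(\nu_i)[g(a_i)-g(a_{i-1})]$ over partitions $a=a_0<\dots<a_l=b$ with tags $\nu_i\in[a_{i-1};a_i]$ converge to a common limit as the mesh $\max_i(a_i-a_{i-1})\to0$, independently of the choice of tags. *)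

(* Defs.v *)
From HB Require Import structures.
From mathcomp Require Import all_boot all_order all_algebra.
From mathcomp Require Import all_classical all_reals all_analysis.
Set Implicit Arguments. Unset Strict Implicit. Unset Printing Implicit Defensive.
Import Order.TTheory GRing.Theory Num.Theory.
Import numFieldNormedType.Exports.
Local Open Scope classical_set_scope.
Local Open Scope ring_scope.

Section Defs.
Variable R : realType.

Definition regulated (h : R -> R) (a b : R) : Prop :=
  (exists l : R, h x @[x --> a^'+] --> l) /\
  (exists l : R, h x @[x --> b^'-] --> l) /\
  (forall x, a < x < b ->
     (exists l : R, h t @[t --> x^'-] --> l) /\
     (exists l : R, h t @[t --> x^'+] --> l)).

Definition cont_at_in (h : R -> R) (a b x : R) : Prop :=
  forall e : R, 0 < e -> exists2 d : R, 0 < d &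
    forall y, a <= y <= b -> `|y - x| < d -> `|h y - h x| < e.

Definition varsum (h : R -> R) (s : seq R) : R :=
  \sum_(i < (size s).-1) `|h (nth 0 s i.+1) - h (nth 0 s i)|.

Definition TV0 (h : R -> R) (a b : R) : \bar R :=
  ereal_sup [set (varsum h s)%:E | s in
     [set s : seq R | sorted <%R s /\ all (fun t => a <= t <= b) s]].

Definition TV (h : R -> R) (a b delta : R) : \bar R :=
  ereal_inf [set TV0 u a b | u in
     [set u : R -> R | forall t, a <= t <= b -> `|h t - u t| <= delta / 2]].

Definition tagged_partition (a b : R) (p nu : seq R) : Prop :=
  [/\ size p = (size nu).+1, nth 0 p 0 = a, last 0 p = b, sorted <%R p &
      forall i, (i < size nu)%N -> nth 0 p i <= nth 0 nu i <= nth 0 p i.+1].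

Definition mesh (p : seq R) : R :=
  \big[Num.max/0]_(i < (size p).-1) (nth 0 p i.+1 - nth 0 p i).

Definition RS_sum (f g : R -> R) (p nu : seq R) : R :=
  \sum_(i < size nu) f (nth 0 nu i) * (g (nth 0 p i.+1) - g (nth 0 p i)).

Definition RS_integral (f g : R -> R) (a b I : R) : Prop :=
  forall e : R, 0 < e -> exists2 d : R, 0 < d &
    forall p nu, tagged_partition a b p nu -> mesh p < d ->
      `|RS_sum f g p nu - I| < e.

Definition theta_prev (g : R -> R) (a b : R) (theta : nat -> R) (k : nat) : \bar R :=
  if k is k'.+1 then (theta k')%:E
  else ereal_sup [set (`|g b - g t|)%:E | t in [set t | a <= t <= b]].

Definition S_tilde (f g : R -> R) (a b : R) (eta theta : nat -> R) : \bar R :=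
  ((\sum_(0 <= k <oo) ((2 ^+ k)%:E * theta_prev g a b theta k * TV f a b (eta k)))
 + (\sum_(0 <= k <oo) ((2 ^+ k * eta k)%:E * TV g a b (theta k))))%E.

End Defs.

(* Main.v *)
(* The sum [rsum f g x l - f x * (g (end) - g x)] (the defect of a tagged chain) is
   bilinear in (f, g). Summing by parts on the left, it is at most
   osc g * Var f; directly, it is at most osc f * Var g. Choose functions f_k, g_k
   of nearly minimal variation with |f - f_k| <= eta_k / 2, |g - g_k| <= theta_k / 2.
   Replacing alternately f - f_k by f - f_(k+1) and g - g_k by g - g_(k+1) costs
   theta_k * Var (f_(k+1) - f_k) + eta_(k+1) * Var (g_(k+1) - g_k), which is at most
   2 theta_k * TV(f, eta_(k+1)) + 2 eta_(k+1) * TV(g, theta_(k+1)) since TV is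
   monotone in its parameter, and what is left after n steps is at most
   (number of tags) * eta_n * theta_n, which vanishes in the limit for a fixed
   partition. This bounds every Riemann-Stieltjes sum by S_tilde.
   For existence, two partitions are compared through their common refinement:
   the difference is a sum of defects over short intervals. As f and g have no
   common discontinuity, by a Lebesgue number argument each such interval sees a
   small oscillation of f or of g, so on it one may peel off f_N and g_N in the
   favourable order; the defects of f - f_N against g - g_N are bounded by the
   tail of S_tilde. If some eta_k or theta_k is 0, finiteness of S_tilde makes f or
   g of bounded variation, and the other one, being regulated, is a uniform limit
   of functions of bounded variation. *)
Require Import Defs.
From HB Require Import structures.
From mathcomp Require Import all_boot all_order all_algebra.
From mathcomp Require Import all_classical all_reals all_analysis.
From mathcomp Require Import ring lra.
Set Implicit Arguments. Unset Strict Implicit. Unset Printing Implicit Defensive.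
Import Order.TTheory GRing.Theory Num.Theory.
Import numFieldNormedType.Exports.
Local Open Scope classical_set_scope.
Local Open Scope ring_scope.

(** * Tagged chains *)

Section Chains.
Context {R : realType}.
Implicit Types (a b c x y z K M : R) (f g u v : R -> R).
Implicit Types (s : seq R) (l : seq (R * R)) (ls : seq (seq (R * R))).

Fixpoint pathvar u x s : R :=
  if s is y :: s' then `|u y - u x| + pathvar u y s' else 0.

Definition var_le u a b M := forall x s,
  a <= x -> path <=%R x s -> last x s <= b -> pathvar u x s <= M.

(* A tagged partition of an interval starting at [x] is coded by the list of
   its pairs (tag, right endpoint). *)
Fixpoint chain x l : bool :=
  if l is (t, y) :: l' then (x <= t <= y) && chain y l' else true.

Definition chain_end x l : R := last x (unzip2 l).

Fixpoint rsum f g x l : R :=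
  if l is (t, y) :: l' then f t * (g y - g x) + rsum f g y l' else 0.

(* [c] plays the role of the previous tag, which lets the induction on [l] perform
   the summation by parts. *)
Definition defect c x l f g : R :=
  rsum f g x l - f c * (g (chain_end x l) - g x).

(* [ls] is a chain cut into consecutive blocks. *)
Fixpoint defects x ls f g : R :=
  if ls is l :: ls' then `|defect x x l f g| + defects (chain_end x l) ls' f g
  else 0.

Lemma pathvar_ge0 u x s : 0 <= pathvar u x s.
Proof. by elim: s x => //= y s IH x; rewrite addr_ge0. Qed.

Lemma pathvar_cat u x s1 s2 :
  pathvar u x (s1 ++ s2) = pathvar u x s1 + pathvar u (last x s1) s2.
Proof. by elim: s1 x => /= [|y s IH] x; rewrite ?add0r // IH addrA. Qed.

Lemma pathvarB_le u v x s :
  pathvar (u \- v) x s <= pathvar u x s + pathvar v x s.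
Proof.
elim: s x => /= [|y s IH] x; first by rewrite addr0.
have -> : u y - v y - (u x - v x) = (u y - u x) - (v y - v x) by ring.
have := ler_normB (u y - u x) (v y - v x); have := IH y; lra.
Qed.

Lemma path_ltW x s : path <%R x s -> path <=%R x s.
Proof. by apply: sub_path => ? ?; apply: ltW. Qed.

Lemma path_le_last x s : path <=%R x s -> x <= last x s.
Proof. by elim: s x => //= y s IH x /andP[xy /IH]; apply: le_trans. Qed.

Lemma chain_path_ends x l : chain x l -> path <=%R x (unzip2 l).
Proof.
elim: l x => //= -[t y] l IH x /andP[/andP[xt ty] /IH] /= ->.
by rewrite (le_trans xt ty).
Qed.

Lemma chain_end_ge x l : chain x l -> x <= chain_end x l.
Proof. by move=> /chain_path_ends /path_le_last. Qed.

Lemma chain_path_tags c x l : c <= x -> chain x l ->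
  path <=%R c (unzip1 l) /\ last c (unzip1 l) <= chain_end x l.
Proof.
elim: l c x => //= -[t y] l IH c x cx /andP[/andP[xt ty] yl] /=.
by rewrite (le_trans cx xt) /=; apply: IH.
Qed.

Lemma chain_cat x l1 l2 :
  chain x (l1 ++ l2) = chain x l1 && chain (chain_end x l1) l2.
Proof. by elim: l1 x => //= -[t y] l IH x; rewrite IH andbA. Qed.

Lemma chain_end_cat x l1 l2 :
  chain_end x (l1 ++ l2) = chain_end (chain_end x l1) l2.
Proof. by rewrite /chain_end /unzip2 map_cat last_cat. Qed.

Lemma rsum_cat f g x l1 l2 :
  rsum f g x (l1 ++ l2) = rsum f g x l1 + rsum f g (chain_end x l1) l2.
Proof. by elim: l1 x => [|[t y] l IH] x /=; rewrite ?add0r // IH addrA. Qed.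

Lemma defect_cons c x t y l f g : defect c x ((t, y) :: l) f g =
  (f t - f c) * (g (chain_end y l) - g x) + defect t y l f g.
Proof. by rewrite /defect /= -/(chain_end y l); ring. Qed.

Lemma defect_cons' c x t y l f g : defect c x ((t, y) :: l) f g =
  (f t - f c) * (g y - g x) + defect c y l f g.
Proof. by rewrite /defect /= -/(chain_end y l); ring. Qed.

Lemma rsumBl f f' g x l : rsum (f \- f') g x l = rsum f g x l - rsum f' g x l.
Proof. by elim: l x => [|[t y] l IH] x /=; rewrite ?subr0 // IH; ring. Qed.

Lemma rsumBr f g g' x l : rsum f (g \- g') x l = rsum f g x l - rsum f g' x l.
Proof. by elim: l x => [|[t y] l IH] x /=; rewrite ?subr0 // IH; ring. Qed.

Lemma defectBl c x l f f' g :
  defect c x l (f \- f') g = defect c x l f g - defect c x l f' g.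
Proof. by rewrite /defect rsumBl /=; ring. Qed.

Lemma defectBr c x l f g g' :
  defect c x l f (g \- g') = defect c x l f g - defect c x l f g'.
Proof. by rewrite /defect rsumBr /=; ring. Qed.

(** Abel summation writes the defect as the sum of [(u t_i - u t_(i-1)) * (g z - g x_(i-1))], where
    [t_0 = c] and [z] is the end of the chain, so [g] is only compared with its value at [z]. *)
Lemma defect_le_tags c x l u g K : chain x l ->
  (forall y, x <= y <= chain_end x l -> `|g (chain_end x l) - g y| <= K) ->
  `|defect c x l u g| <= K * pathvar u c (unzip1 l).
Proof.
elim: l c x => [|[t y] l IH] c x.
  by rewrite /defect /= subrr mulr0 subr0 normr0 mulr0.
move=> xl gK; rewrite defect_cons [pathvar _ _ _]/=; apply: le_trans (ler_normD _ _) _.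
have xz := chain_end_ge xl.
have /= := xl => /andP[/andP[xt ty] yl]; rewrite [K * _]mulrDr lerD //.
  by rewrite normrM [K * _]mulrC ler_wpM2l // gK // lexx.
apply: IH => // w /andP[yw wz]; apply: gK.
by rewrite wz (le_trans _ yw) // (le_trans xt).
Qed.

(** Without summation by parts, the defect is the sum of [(u t_i - u c) * (g x_i - g x_(i-1))]. *)
Lemma defect_le_ends c x l u g K : chain x l ->
  (forall t, x <= t <= chain_end x l -> `|u t - u c| <= K) ->
  `|defect c x l u g| <= K * pathvar g x (unzip2 l).
Proof.
elim: l x => [|[t y] l IH] x.
  by rewrite /defect /= subrr mulr0 subr0 normr0 mulr0.
move=> xl uK; rewrite defect_cons' [pathvar _ _ _]/=; apply: le_trans (ler_normD _ _) _.
have /= := xl => /andP[/andP[xt ty] yl]; rewrite [K * _]mulrDr lerD //.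
  rewrite normrM ler_wpM2r // uK // xt /=.
  exact: le_trans ty (chain_end_ge yl).
apply: IH => // w /andP[yw wz]; apply: uK.
by rewrite wz (le_trans _ yw) // (le_trans xt).
Qed.

Lemma pathvar_le_size g x s K : path <=%R x s ->
  (forall y z, x <= y <= last x s -> x <= z <= last x s -> `|g y - g z| <= K) ->
  pathvar g x s <= (size s)%:R * K.
Proof.
elim: s x => [|y s IH] x /=; first by rewrite mul0r.
move=> /andP[xy ys] gK; have yl := path_le_last ys.
rewrite -addn1 natrD mulrDl mul1r addrC lerD //.
  apply: IH => // w z /andP[yw wl] /andP[yz zl]; apply: gK.
    by rewrite wl (le_trans xy).
  by rewrite zl (le_trans xy).
by apply: gK; rewrite ?xy ?yl ?lexx ?(le_trans xy).
Qed.

(* Sums over the blocks of the variation of [u] along the tags, resp. along the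
   endpoints, each block starting from its left endpoint. *)
Fixpoint tagvar u x ls : R :=
  if ls is l :: ls' then pathvar u x (unzip1 l) + tagvar u (chain_end x l) ls'
  else 0.

Fixpoint endvar u x ls : R :=
  if ls is l :: ls' then pathvar u x (unzip2 l) + endvar u (chain_end x l) ls'
  else 0.

Lemma endvarE u x ls : endvar u x ls = pathvar u x (unzip2 (flatten ls)).
Proof.
elim: ls x => //= l ls IH x.
by rewrite /unzip2 map_cat pathvar_cat IH.
Qed.

(* Inserting the end of each block between the tags of consecutive blocks only
   increases the variation. *)
Lemma tagvar_path u x ls : chain x (flatten ls) -> exists s,
  [/\ path <=%R x s, last x s = chain_end x (flatten ls) &
      tagvar u x ls <= pathvar u x s].
Proof.
elim: ls x => [|l ls IH] x /=; first by exists [::].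
rewrite chain_cat => /andP[xl /IH[s [ps ls' us]]].
have [pl lastl] := chain_path_tags (lexx x) xl.
exists (unzip1 l ++ chain_end x l :: s); split.
- by rewrite cat_path pl /= lastl.
- by rewrite last_cat /= chain_end_cat.
- by rewrite pathvar_cat lerD2l /= (le_trans us) // lerDr.
Qed.

Lemma tagvar_le a b u x ls M : var_le u a b M -> a <= x ->
  chain x (flatten ls) -> chain_end x (flatten ls) <= b -> tagvar u x ls <= M.
Proof.
move=> uM ax /(tagvar_path u)[s [ps <- us]] zb.
exact: le_trans us (uM _ _ ax ps zb).
Qed.

Lemma endvar_le a b u x ls M : var_le u a b M -> a <= x ->
  chain x (flatten ls) -> chain_end x (flatten ls) <= b -> endvar u x ls <= M.
Proof.
by move=> uM ax /chain_path_ends pe zb; rewrite endvarE; apply: uM.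
Qed.

End Chains.

(** * Truncated variation *)

Section TruncatedVariation.
Context {R : realType}.
Implicit Types (a b c x y z K M e d : R) (f g u v w : R -> R).
Implicit Types (s : seq R) (l : seq (R * R)) (ls : seq (seq (R * R))).

Lemma varsum_cons u x s : varsum u (x :: s) = pathvar u x s.
Proof.
rewrite /varsum /=; elim: s x => [|y s IH] x /=; first by rewrite big_ord0.
by rewrite big_ord_recl /= -IH.
Qed.

Lemma pathvar_strict u x s : path <=%R x s -> exists s',
  [/\ path <%R x s', last x s' = last x s & pathvar u x s' = pathvar u x s].
Proof.
elim: s x => [|y s IH] x /=; first by exists [::].
move=> /andP[]; rewrite le_eqVlt => /orP[/eqP <-|xy] /IH[s' [ps' ls' us']].
  by exists s'; rewrite subrr normr0 add0r.
by exists (y :: s'); rewrite /= xy us'.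
Qed.

Lemma pathvar_le_TV0 a b u x s : a <= x -> path <=%R x s -> last x s <= b ->
  ((pathvar u x s)%:E <= TV0 u a b)%E.
Proof.
move=> ax /(pathvar_strict u)[s' [ps' <- <-]] lb.
apply: ereal_sup_ubound; exists (x :: s'); last by rewrite varsum_cons.
split => //.
have ps := path_ltW ps'.
apply/allP => t.
elim: s' x ax ps {ps'} lb => [|y s' IH] x ax /=.
  by move=> _ xb; rewrite inE => /eqP ->; rewrite ax.
move=> /andP[xy ys] lb; rewrite inE => /orP[/eqP ->|].
  by rewrite ax (le_trans _ lb) // (le_trans xy) // path_le_last.
by apply: IH => //; apply: le_trans xy.
Qed.

Lemma TV0_ge0 a b u : (0 <= TV0 u a b)%E.
Proof.
by apply: ereal_sup_ubound; exists [::] => //; rewrite /varsum big_ord0.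
Qed.

Lemma TV_ge0 a b f d : (0 <= TV f a b d)%E.
Proof. by apply: le_ereal_inf_tmp => _ [u _ <-]; exact: TV0_ge0. Qed.

Lemma TV_le a b f d d' : d' <= d -> (TV f a b d <= TV f a b d')%E.
Proof.
move=> dd'; apply: ereal_inf_le_tmp => _ [u fu <-]; exists u => // t /fu /le_trans.
by apply; rewrite ler_pM2r // invr_gt0.
Qed.

Definition near_on a b f u d := forall t, a <= t <= b -> `|f t - u t| <= d / 2.

(** Kept in the extended reals, so that it imposes nothing when the truncated variation is
    infinite. *)
Definition pathvar_near_TV a b f u d e := forall x s,
  a <= x -> path <=%R x s -> last x s <= b ->
  ((pathvar u x s)%:E <= TV f a b d + e%:E)%E.

Lemma TV_approx a b f d e : 0 <= d -> 0 < e ->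
  exists u, near_on a b f u d /\ pathvar_near_TV a b f u d e.
Proof.
move=> d0 e0; have [fin|] := boolP (TV f a b d \is a fin_num).
  have [_ [u fu <-] le] := lb_ereal_inf_adherent e0 fin.
  exists u; split => // x s ax ps lb.
  exact: le_trans (pathvar_le_TV0 _ ax ps lb) (ltW le).
rewrite ge0_fin_numE ?TV_ge0// ltey negbK => /eqP TVoo.
exists f; split => [t _|x s _ _ _]; first by rewrite subrr normr0 divr_ge0.
by rewrite TVoo addye // leey.
Qed.

(** A zero weight gives no information on [T], since [0 * +oo = 0], but then the claim is just
    [0 <= X]; a positive weight forces [T] to be finite. *)
Lemma weighted_le (c p e X : R) (T : \bar R) : 0 <= c -> (0 <= T)%E ->
  (c%:E * T <= X%:E)%E -> (p%:E <= T + e%:E)%E -> c * p <= X + c * e.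
Proof.
rewrite le_eqVlt => /orP[/eqP <- _|c0].
  by rewrite mul0e lee_fin !mul0r addr0.
case: T => [t| |] //=; last by rewrite gt0_muley.
rewrite !lee_fin => _ tX pt; rewrite (le_trans (ler_wpM2l (ltW c0) pt)) //.
by rewrite mulrDr lerD2r.
Qed.

Definition osc_le a b f K :=
  forall y z, a <= y <= b -> a <= z <= b -> `|f y - f z| <= K.

Lemma near_on_osc a b f u d : near_on a b f u d -> osc_le a b (f \- u) d.
Proof.
move=> fu s t /fu sd /fu td; apply: le_trans (ler_normB _ _) _ => /=; lra.
Qed.

Lemma osc_le_sub a b f K x y :
  a <= x -> y <= b -> osc_le a b f K -> osc_le x y f K.
Proof.
move=> ax yb fK s t /andP[xs sy] /andP[xt ty].
by apply: fK; rewrite ?(le_trans ax) // (le_trans _ yb).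
Qed.

Lemma defect_tags_step x l f g u K : chain x l ->
  osc_le x (chain_end x l) g K ->
  `|defect x x l f g| <=
    K * pathvar u x (unzip1 l) + `|defect x x l (f \- u) g|.
Proof.
move=> xl gK; rewrite defectBl.
have : `|defect x x l u g| <= K * pathvar u x (unzip1 l).
  by apply: defect_le_tags => // y xy; apply: gK; rewrite // chain_end_ge /=.
have := ler_normD (defect x x l f g - defect x x l u g) (defect x x l u g).
by rewrite subrK => /le_trans h1 h2; apply: h1; rewrite addrC lerD2r.
Qed.

Lemma defect_ends_step x l f g v K : chain x l ->
  osc_le x (chain_end x l) f K ->
  `|defect x x l f g| <=
    K * pathvar v x (unzip2 l) + `|defect x x l f (g \- v)|.
Proof.
move=> xl fK; rewrite defectBr.
have : `|defect x x l f v| <= K * pathvar v x (unzip2 l).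
  by apply: defect_le_ends => // y xy; apply: fK; rewrite // lexx chain_end_ge.
have := ler_normD (defect x x l f g - defect x x l f v) (defect x x l f v).
by rewrite subrK => /le_trans h1 h2; apply: h1; rewrite addrC lerD2r.
Qed.

Lemma defects_tags_step a b x ls f g u K : osc_le a b g K -> a <= x ->
  chain x (flatten ls) -> chain_end x (flatten ls) <= b ->
  defects x ls f g <= K * tagvar u x ls + defects x ls (f \- u) g.
Proof.
move=> gK; elim: ls x => [|l ls IH] x ax /=; first by rewrite mulr0 addr0.
rewrite chain_cat chain_end_cat => /andP[xl ys] zb; rewrite mulrDr addrACA.
have xy := chain_end_ge xl; have yz := chain_end_ge ys.
apply: lerD; last by apply: IH => //; apply: le_trans xy.
by apply: defect_tags_step => //; apply: osc_le_sub gK => //; apply: le_trans zb.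
Qed.

Lemma defects_ends_step a b x ls f g v K : osc_le a b f K -> a <= x ->
  chain x (flatten ls) -> chain_end x (flatten ls) <= b ->
  defects x ls f g <= K * endvar v x ls + defects x ls f (g \- v).
Proof.
move=> fK; elim: ls x => [|l ls IH] x ax /=; first by rewrite mulr0 addr0.
rewrite chain_cat chain_end_cat => /andP[xl ys] zb; rewrite mulrDr addrACA.
have xy := chain_end_ge xl; have yz := chain_end_ge ys.
apply: lerD; last by apply: IH => //; apply: le_trans xy.
by apply: defect_ends_step => //; apply: osc_le_sub fK => //; apply: le_trans zb.
Qed.

(** Crude bound for what telescoping leaves over: each endpoint contributes one increment of [g]. It
    is useful once [K * K'] is small compared with a fixed number of points. *)
Lemma defects_le_size a b x ls f g K K' : 0 <= K -> osc_le a b f K ->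
  osc_le a b g K' -> a <= x ->
  chain x (flatten ls) -> chain_end x (flatten ls) <= b ->
  defects x ls f g <= (size (flatten ls))%:R * (K * K').
Proof.
move=> K0 fK gK; elim: ls x => [|l ls IH] x ax /=; first by rewrite mul0r.
rewrite chain_cat chain_end_cat => /andP[xl ys] zb.
have xy := chain_end_ge xl; have yz := chain_end_ge ys.
have yb := le_trans yz zb.
rewrite size_cat natrD mulrDl lerD //; last by apply: IH => //; apply: le_trans xy.
have fK' := osc_le_sub ax yb fK; have gK' := osc_le_sub ax yb gK.
apply: (@le_trans _ _ (K * pathvar g x (unzip2 l))).
  by apply: defect_le_ends => // t xt; apply: fK'; rewrite // lexx.
rewrite mulrCA ler_wpM2l // -(size_map snd); apply: pathvar_le_size => //.
exact: chain_path_ends.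
Qed.

(** Each induction step trades [u] for an approximant [u'] of level [m.+1] by summation by parts, at
    cost [theta m] times the variation of [u' - u], and then [v] for [v'] directly, at cost
    [eta m.+1] times the variation of [v' - v]. The terms with [er] collect the errors of
    near-minimality. *)
Lemma defects_telescope a b f g (eta theta X Y er : nat -> R) :
  (forall k, 0 <= eta k) -> (forall k, eta k.+1 <= eta k) ->
  (forall k, 0 <= theta k) -> (forall k, theta k.+1 <= theta k) ->
  (forall k, ((theta k)%:E * TV f a b (eta k.+1) <= (X k)%:E)%E) ->
  (forall k, ((eta k.+1)%:E * TV g a b (theta k.+1) <= (Y k)%:E)%E) ->
  (forall k, 0 < er k) -> (forall k, er k.+1 <= er k) ->
  forall (n m : nat) u v x ls,
  near_on a b f u (eta m) -> pathvar_near_TV a b f u (eta m) (er m) ->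
  near_on a b g v (theta m) -> pathvar_near_TV a b g v (theta m) (er m) ->
  a <= x -> chain x (flatten ls) -> chain_end x (flatten ls) <= b ->
  defects x ls (f \- u) (g \- v) <=
    \sum_(m <= k < m + n) (2 * X k + 2 * Y k + 2 * (theta k + eta k.+1) * er k)
    + (size (flatten ls))%:R * (eta (m + n)%N * theta (m + n)%N).
Proof.
move=> eta0 etaS theta0 thetaS XP YP er0 erS.
elim=> [|n IH] m u v x ls fu uTV gv vTV ax xl zb.
  rewrite addn0 big_geq // add0r.
  by apply: (@defects_le_size a b) => //; exact: near_on_osc.
have [u' [fu' u'TV]] := TV_approx a b f (eta0 m.+1) (er0 m.+1).
have [v' [gv' v'TV]] := TV_approx a b g (theta0 m.+1) (er0 m.+1).
have {IH} := IH m.+1 u' v' x ls fu' u'TV gv' v'TV ax xl zb.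
rewrite addSnnS (@big_ltn _ _ _ m) ?addnS ?ltnS ?leq_addr //.
have sub2 (h p q : R -> R) : (h \- p) \- (q \- p) = h \- q.
  by apply/funext => t /=; ring.
have := @defects_tags_step a b x ls (f \- u) (g \- v) (u' \- u) _
  (near_on_osc gv) ax xl zb.
rewrite sub2.
have := @defects_ends_step a b x ls (f \- u') (g \- v) (v' \- v) _
  (near_on_osc fu') ax xl zb.
rewrite sub2.
have tagb : theta m * tagvar (u' \- u) x ls <= 2 * X m + 2 * (theta m * er m).
  have [s [ps ls' us]] := tagvar_path (u' \- u) xl.
  rewrite -ls' in zb.
  apply: le_trans (ler_wpM2l (theta0 m) (le_trans us (pathvarB_le _ _ _ _))) _.
  have h1 := weighted_le (theta0 m) (TV_ge0 _ _ _ _) (XP m) (u'TV _ _ ax ps zb).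
  (* The old approximant belongs to the larger parameter [eta m], so by monotonicity [X m] serves
     for both approximants; hence the factor 2. *)
  have TVm : ((theta m)%:E * TV f a b (eta m) <= (X m)%:E)%E.
    by apply: le_trans (XP m); rewrite lee_pmul ?lee_fin ?TV_ge0 ?TV_le.
  have h2 := weighted_le (theta0 m) (TV_ge0 _ _ _ _) TVm (uTV _ _ ax ps zb).
  have := ler_wpM2l (theta0 m) (erS m); rewrite mulrDr; lra.
have endb : eta m.+1 * endvar (v' \- v) x ls <= 2 * Y m + 2 * (eta m.+1 * er m).
  rewrite endvarE; have ps := chain_path_ends xl.
  apply: le_trans (ler_wpM2l (eta0 _) (pathvarB_le _ _ _ _)) _.
  have h1 := weighted_le (eta0 _) (TV_ge0 _ _ _ _) (YP m) (v'TV _ _ ax ps zb).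
  have TVm : ((eta m.+1)%:E * TV g a b (theta m) <= (Y m)%:E)%E.
    by apply: le_trans (YP m); rewrite lee_pmul ?lee_fin ?TV_ge0 ?TV_le.
  have h2 := weighted_le (eta0 _) (TV_ge0 _ _ _ _) TVm (vTV _ _ ax ps zb).
  have := ler_wpM2l (eta0 m.+1) (erS m); rewrite mulrDr; lra.
lra.
Qed.

End TruncatedVariation.

(** * Regulated functions *)

Section Regulated.
Context {R : realType}.
Implicit Types (a b c x y z K M e d l r : R) (f g h u v w : R -> R) (s : seq R).

Lemma right_limitP h x l e : h t @[t --> x^'+] --> l -> 0 < e ->
  exists2 r, 0 < r & forall t, x < t < x + r -> `|h t - l| <= e.
Proof.
move=> /cvgrPdist_le + e0 => /(_ _ e0)[r /= r0 xr].
exists r => // t /andP[xt tr]; rewrite distrC; apply: xr => //=.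
by rewrite ltr0_norm; lra.
Qed.

Lemma left_limitP h x l e : h t @[t --> x^'-] --> l -> 0 < e ->
  exists2 r, 0 < r & forall t, x - r < t < x -> `|h t - l| <= e.
Proof.
move=> /cvgrPdist_le + e0 => /(_ _ e0)[r /= r0 xr].
exists r => // t /andP[tr tx]; rewrite distrC; apply: xr => //=.
by rewrite gtr0_norm; lra.
Qed.

Lemma regulated_right a b h x e : regulated h a b -> a <= x < b -> 0 < e ->
  exists l r, 0 < r /\ forall t, x < t < x + r -> `|h t - l| <= e.
Proof.
move=> [[la hla] [_ hx]] /andP[]; rewrite le_eqVlt => /orP[/eqP <-|ax] xb e0.
  by have [r ? ?] := right_limitP hla e0; exists la, r.
have [|_ [l hl]] := hx x; first by rewrite ax.
by have [r ? ?] := right_limitP hl e0; exists l, r.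
Qed.

Lemma regulated_left a b h x e : regulated h a b -> a < x <= b -> 0 < e ->
  exists l r, 0 < r /\ forall t, x - r < t < x -> `|h t - l| <= e.
Proof.
move=> [_ [[lb hlb] hx]] /andP[ax]; rewrite le_eqVlt => /orP[/eqP ->|xb] e0.
  by have [r ? ?] := left_limitP hlb e0; exists lb, r.
have [|[l hl] _] := hx x; first by rewrite ax.
by have [r ? ?] := left_limitP hl e0; exists l, r.
Qed.

Lemma pathvar_min u y x s :
  pathvar (fun t => u (Num.min t y)) x s =
  pathvar u (Num.min x y) [seq Num.min t y | t <- s].
Proof. by elim: s x => //= z s IH x; rewrite IH. Qed.

Lemma path_min y x s : path <=%R x s ->
  path <=%R (Num.min x y) [seq Num.min t y | t <- s].
Proof.
by apply: homo_path => p q pq; rewrite le_min ge_min pq /= ge_min lexx orbT.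
Qed.

Lemma pathvar_step c (P : pred R) x s : (forall y z, y <= z -> P y -> P z) ->
  path <=%R x s ->
  pathvar (fun t => if P t then c else 0) x s <= if P x then 0 else `|c|.
Proof.
move=> Pmono; elim: s x => [|y s IH] x /=; first by case: ifP.
move=> /andP[xy /IH]; have := Pmono x y xy.
case: (P x) => [->//|_]; first by rewrite subrr normr0 add0r.
by case: (P y); rewrite !(subr0, subrr) ?normr0 ?add0r // => ?; rewrite gerDl.
Qed.

Definition bounded_var u := exists M, forall x s,
  path <=%R x s -> pathvar u x s <= M.

Lemma bounded_varB u v : bounded_var u -> bounded_var v ->
  bounded_var (u \- v).
Proof.
move=> [M uM] [N vN]; exists (M + N) => x s ps.
by apply: le_trans (pathvarB_le _ _ _ _) _; rewrite lerD ?uM ?vN.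
Qed.

Lemma bounded_var_step c (P : pred R) : (forall y z, y <= z -> P y -> P z) ->
  bounded_var (fun t => if P t then c else 0).
Proof.
move=> Pmono; exists `|c| => x s /(pathvar_step c Pmono) /le_trans; apply.
by case: ifP.
Qed.

(** The new function is [u] frozen at its value [u y] beyond [y] and corrected by two steps, so that
    it equals [l] between [y] and [z] and [f z] from [z] on. *)
Lemma near_on_extend a y z f u d l : bounded_var u -> near_on a y f u d ->
  0 <= d -> y < z -> (forall t, y < t < z -> `|f t - l| <= d / 2) ->
  exists2 u', bounded_var u' & near_on a z f u' d.
Proof.
move=> [M uM] fu d0 yz fl.
exists ((fun t => u (Num.min t y)) \-
        (fun t => if y < t then u y - l else 0) \-
        (fun t => if z <= t then l - f z else 0)).
  apply: bounded_varB; last first.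
    by apply: bounded_var_step => p q pq; move/le_trans; apply.
  apply: bounded_varB; last first.
    by apply: bounded_var_step => p q pq; move/lt_le_trans; apply.
  by exists M => x s ps; rewrite pathvar_min uM // path_min.
move=> t /andP[at_ tz] /=; case: (leP t y) => ty.
  by rewrite [z <= t]leNgt (le_lt_trans ty yz) /= !subr0 fu // at_.
rewrite subKr; case: (leP z t) => zt.
  have -> : t = z by apply/eqP; rewrite eq_le tz.
  by rewrite subKr subrr normr0 divr_ge0.
by rewrite subr0 fl // ty.
Qed.

(** Let [c] be the supremum of the points up to which an approximation exists. The left limit at [c]
    shows that it is attained; if [c < b], the right limit at [c] leads beyond it. *)
Lemma regulated_bounded_var a b f d : a <= b -> regulated f a b -> 0 < d ->
  exists2 u, bounded_var u & near_on a b f u d.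
Proof.
move=> ab fr d0; have d20 : 0 < d / 2 by rewrite divr_gt0.
pose E : set R := [set x | a <= x <= b /\
  exists2 u, bounded_var u & near_on a x f u d].
have Ea : E a.
  split; first by rewrite lexx.
  exists (fun=> f a); last first.
    move=> t; rewrite -eq_le => /eqP <-.
    by rewrite subrr normr0 ltW.
  exists 0 => x s _; elim: s x => //= y s IH x.
  by rewrite subrr normr0 add0r.
have Eb : ubound E b by move=> x [/andP[]].
have supE : has_sup E by split; [exists a|exists b].
pose c := sup E.
have ac : a <= c by apply: ub_le_sup => //; exists b.
have cb : c <= b by apply: ge_sup => //; exists a.
have Ec : E c.
  have [->//|ac'] := eqVneq c a.
  have {}ac : a < c by rewrite lt_def ac'.
  have [|l [r [r0 fl]]] := regulated_left fr (x := c) _ d20; first by rewrite ac.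
  have [y [ayb [u bu uy]] cy] := sup_adherent r0 supE.
  have yc : y <= c by apply: ub_le_sup; [exists b|split => //; exists u].
  have [yc'|yc'] := eqVneq y c; first by rewrite -yc'; split => //; exists u.
  split; first by rewrite (ltW ac).
  apply: (near_on_extend (l := l) bu uy (ltW d0)).
    by rewrite lt_neqAle yc'.
  by move=> t /andP[yt tc]; apply: fl; rewrite tc (lt_trans cy).
have [bc|bc] := leP b c.
  by have {bc} <- : c = b by [apply/eqP; rewrite eq_le cb]; case: Ec.
have [|l [r [r0 fl]]] := regulated_right fr (x := c) _ d20; first by rewrite ac.
have [_ [u bu uc]] := Ec.
pose z := Num.min (c + r / 2) b.
have cz : c < z by rewrite lt_min bc andbT; lra.
have : E z.
  split; first by rewrite (le_trans ac (ltW cz)) ge_min lexx orbT.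
  apply: (near_on_extend (l := l) bu uc (ltW d0) cz).
  move=> t /andP[ct]; rewrite lt_min => /andP[tr _]; apply: fl.
  by rewrite ct /=; lra.
move=> Ez; have : z <= c by apply: ub_le_sup => //; exists b.
by rewrite leNgt cz.
Qed.

Lemma bounded_var_le u a b : bounded_var u -> exists M, var_le u a b M.
Proof. by case=> M uM; exists M => x s _ + _; apply: uM. Qed.

Lemma regulated_osc a b f : a <= b -> regulated f a b -> exists K, osc_le a b f K.
Proof.
move=> ab fr; have [u [M uM] fu] := regulated_bounded_var ab fr ltr01.
have uy y : a <= y <= b -> `|u y - u a| <= M.
  by move=> /andP[ay _]; have := uM a [:: y]; rewrite /= andbT addr0; apply.
exists (2 * M + 1) => y z ay az.
have := fu y ay; have := fu z az; have := uy y ay; have := uy z az.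
rewrite !ler_norml; lra.
Qed.

(** Compactness of the segment in its near-covering form, applied to the filter of small positive
    radii. *)
Lemma lebesgue_number a b (P : R -> R -> Prop) :
  (forall x, a <= x <= b -> exists2 d, 0 < d &
    forall x' d', `|x' - x| < d -> 0 < d' < d -> P d' x') ->
  exists2 d, 0 < d & forall x, a <= x <= b -> P d x.
Proof.
move=> Px; have /compact_near_coveringP cov := @segment_compact R a b.
have [x|d [/= d0 Pd]] := filter_ex (filterI (nbhs_right_gt (0 : R))
    (cov R 0^'+ P _ _)); last first.
  by exists d => // x xab; apply: Pd; rewrite /= in_itv.
rewrite /= in_itv => /Px[d d0 Pd].
exists ([set x' | `|x' - x| < d], [set d' | 0 < d' < d]) => /=; last first.
  by case=> x' d' /= [xx' d'd]; apply: Pd.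
split; last by exists d => //= d' /=; rewrite sub0r normrN => + d'0;
  rewrite gtr0_norm // => ->; rewrite d'0.
by exists d => //= y /=; rewrite distrC.
Qed.

Lemma small_oscillation a b f g e :
  (forall x, a <= x <= b -> cont_at_in f a b x \/ cont_at_in g a b x) -> 0 < e ->
  exists2 d, 0 < d & forall x y, a <= x -> y <= b -> y - x < d ->
    osc_le x y f e \/ osc_le x y g e.
Proof.
move=> fg e0.
have cont h x : cont_at_in h a b x -> exists2 d, 0 < d &
    forall y z, a <= y <= b -> a <= z <= b -> `|y - x| < d -> `|z - x| < d ->
      `|h y - h z| <= e.
  have e20 : 0 < e / 2 by rewrite divr_gt0.
  move=> /(_ _ e20)[d d0 hd]; exists d => // y z ya za /(hd _ ya) + /(hd _ za).
  rewrite !ltr_norml ler_norml; lra.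
pose Q h d x := forall y z, a <= y <= b -> a <= z <= b ->
  `|y - x| < d -> `|z - x| < d -> `|h y - h z| <= e.
have [|d d0 Pd] := @lebesgue_number a b (fun d x => Q f d x \/ Q g d x).
  (* Halving the radius leaves room to move the centre: points within [d / 2] of [x'] stay within
     [d] of [x]. *)
  have half h x : cont_at_in h a b x -> exists2 d, 0 < d &
    forall x' d', `|x' - x| < d -> 0 < d' < d -> Q h d' x'.
    move=> /cont[d d0 hd]; exists (d / 2); first by rewrite divr_gt0.
    move=> x' d' xx' /andP[_ d'd] y z ya za yx zx; apply: hd => //.
      by move: xx' yx; rewrite !ltr_norml; lra.
    by move: xx' zx; rewrite !ltr_norml; lra.
  move=> x /fg[]/half[d d0 Qd]; exists d => // x' d' xx' dd'.
    by left; apply: Qd.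
  by right; apply: Qd.
exists d => // x y ax yb yx.
have [xy|yx'] := leP x y; last first.
  by left => z z' /andP[xz zy]; move: (le_trans xz zy); rewrite leNgt yx'.
have xb := le_trans xy yb.
have sub h : Q h d x -> osc_le x y h e.
  move=> Qh z z' /andP[xz zy] /andP[xz' zy']; apply: Qh.
  - by rewrite (le_trans ax) // (le_trans zy).
  - by rewrite (le_trans ax) // (le_trans zy').
  - by rewrite ger0_norm; lra.
  - by rewrite ger0_norm; lra.
by have [|/sub|/sub] := Pd x; [rewrite ax|left|right].
Qed.

End Regulated.

(** * Common refinements *)

Section Refinement.
Context {R : realType}.
Implicit Types (a b c x y z K M e d : R) (f g h u v w : R -> R) (s p q : seq R).
Implicit Types (l : seq (R * R)) (ls : seq (seq (R * R))).

Fixpoint short d x ls : Prop :=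
  if ls is l :: ls' then chain_end x l - x < d /\ short d (chain_end x l) ls'
  else True.

Definition singles l : seq (seq (R * R)) := [seq [:: ty] | ty <- l].

Lemma flatten_singles l : flatten (singles l) = l.
Proof. by elim: l => //= ty l ->. Qed.

(** With left endpoints as tags, a chain is determined by its points alone, so two refinements with
    the same points are the same list. *)
Fixpoint left_tagged x s : seq (R * R) :=
  if s is y :: s' then (x, y) :: left_tagged y s' else [::].

Lemma unzip2_left_tagged x s : unzip2 (left_tagged x s) = s.
Proof. by elim: s x => //= y s IH x; rewrite IH. Qed.

Lemma chain_left_tagged x s : path <=%R x s -> chain x (left_tagged x s).
Proof. by elim: s x => //= y s IH x /andP[-> /IH ->]; rewrite lexx. Qed.

Lemma left_tagged_cat x s1 s2 : left_tagged x (s1 ++ s2) =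
  left_tagged x s1 ++ left_tagged (last x s1) s2.
Proof. by elim: s1 x => //= y s IH x; rewrite IH. Qed.

(* The points of [q] subdivide the intervals of the chain [l], with left endpoints
   as tags and one block per interval of [l]. *)
Fixpoint refine q x l : seq (seq (R * R)) :=
  if l is (_, y) :: l' then
    left_tagged x (rcons [seq z <- q | x < z < y] y) :: refine q y l'
  else [::].

Fixpoint refine_pts q x l : seq R :=
  if l is (_, y) :: l' then
    rcons [seq z <- q | x < z < y] y ++ refine_pts q y l'
  else [::].

Lemma flatten_refine q x l :
  flatten (refine q x l) = left_tagged x (refine_pts q x l).
Proof.
elim: l x => //= -[t y] l IH x.
by rewrite left_tagged_cat last_rcons -IH.
Qed.

Lemma chain_end_left_tagged x s : chain_end x (left_tagged x s) = last x s.
Proof. by rewrite /chain_end unzip2_left_tagged. Qed.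

Lemma refine_pts_path q x l : sorted <%R q -> path <%R x (unzip2 l) ->
  path <%R x (refine_pts q x l).
Proof.
move=> sq; elim: l x => //= -[t y] l IH x /= /andP[xy /IH ys].
rewrite cat_path last_rcons ys andbT.
rewrite rcons_path (path_sortedE lt_trans) (sorted_filter lt_trans) // andbT.
apply/andP; split.
  by apply/allP => z; rewrite mem_filter => /andP[/andP[]].
have := mem_last x [seq z <- q | x < z < y].
by rewrite inE mem_filter => /orP[/eqP ->|/andP[/andP[]]].
Qed.

Lemma path_lt_last x s z : path <%R x s -> z \in s -> x < z <= last x s.
Proof.
elim: s x => //= y s IH x /andP[xy ys]; rewrite inE => /orP[/eqP ->|zs].
  by rewrite xy path_le_last // path_ltW.
by have /andP[yz ->] := IH _ ys zs; rewrite (lt_trans xy).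
Qed.

Lemma mem_refine_pts q x l z : path <%R x (unzip2 l) ->
  (z \in refine_pts q x l) =
  (z \in unzip2 l) || (z \in q) && (x < z < chain_end x l).
Proof.
elim: l x => [|[t y] l IH] x /=.
  by move=> _; rewrite in_nil; case: ltgtP => //; rewrite !andbF.
move=> /andP[xy yl]; rewrite mem_cat mem_rcons !inE mem_filter IH // -!orbA.
have [//|zy /=] := eqVneq z y.
have [zl|zl] /= := boolP (z \in unzip2 l); first by rewrite orbT.
rewrite -[chain_end x _]/(chain_end y l).
have yz : y <= chain_end y l by apply/path_le_last/path_ltW.
case: (z \in q); rewrite ?andbF ?andbT //=.
have [zy'|yz'] := ltP z y.
  by rewrite andbT (lt_le_trans zy' yz) !andbT (lt_gtF zy') orbF.
have {yz'}yz' : y < z by rewrite lt_neqAle eq_sym zy.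
by rewrite yz' (lt_trans xy yz') andbF.
Qed.

(** Both sides are carried by the union of the endpoints of [l1] and [l2], and a strictly increasing
    list is determined by its members. The common end, excluded by the strict filter, lies in both
    chains because [a] is below it. *)
Lemma flatten_refineC a l1 l2 : a < chain_end a l1 ->
  chain_end a l1 = chain_end a l2 ->
  path <%R a (unzip2 l1) -> path <%R a (unzip2 l2) ->
  flatten (refine (unzip2 l2) a l1) = flatten (refine (unzip2 l1) a l2).
Proof.
move=> ab e12 p1 p2; rewrite !flatten_refine; congr left_tagged.
have s1 := path_sorted p1; have s2 := path_sorted p2.
apply: lt_sorted_eq.
- exact: path_sorted (refine_pts_path s2 p1).
- exact: path_sorted (refine_pts_path s1 p2).
have mem_last l : a < chain_end a l -> chain_end a l \in unzip2 l.
  rewrite /chain_end; case: (unzip2 l) => [|y s] /=; first by rewrite ltxx.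
  by rewrite mem_last.
have b1 := mem_last _ ab; have b2 := ab; rewrite e12 in b2.
move: b2 => /mem_last; rewrite -e12 => b2.
move=> z; rewrite !mem_refine_pts // -e12.
have [z1|z1] /= := boolP (z \in unzip2 l1); have [z2|z2] //= := boolP (z \in unzip2 l2).
  have /andP[-> zb] := path_lt_last p1 z1.
  rewrite lt_neqAle zb andbT; apply/esym/negP => /eqP zE.
  by move: z2; rewrite zE b2.
have /andP[-> zb] := path_lt_last p2 z2.
rewrite -/(chain_end a l2) -e12 in zb.
rewrite lt_neqAle zb andbT; apply/negP => /eqP zE.
by move: z1; rewrite zE b1.
Qed.

Lemma refine_end q x l :
  chain_end x (flatten (refine q x l)) = chain_end x l.
Proof.
elim: l x => //= -[t y] l IH x.
by rewrite chain_end_cat chain_end_left_tagged last_rcons IH.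
Qed.

Lemma chain_refine q x l : sorted <%R q -> path <%R x (unzip2 l) ->
  chain x (flatten (refine q x l)).
Proof.
move=> sq xl; rewrite flatten_refine chain_left_tagged //.
exact/path_ltW/refine_pts_path.
Qed.

Lemma short_refine d q x l : short d x (singles l) -> short d x (refine q x l).
Proof.
elim: l x => //= -[t y] l IH x /= [xy yl].
by rewrite chain_end_left_tagged last_rcons; split => //; apply: IH.
Qed.

(** On one interval from [x] to [y], both sums are compared with [f x * (g y - g x)]: the coarse one
    deviates by the defect of a single pair, the refined one by that of its block. *)
Lemma rsum_refine_le f g q x l :
  `|rsum f g x l - rsum f g x (flatten (refine q x l))| <=
  defects x (singles l) f g + defects x (refine q x l) f g.
Proof.
elim: l x => [|[t y] l IH] x /=; first by rewrite subrr normr0 addr0.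
rewrite rsum_cat chain_end_left_tagged last_rcons.
rewrite /defect chain_end_left_tagged last_rcons -[chain_end x [:: _]]/y /=.
set B := rsum f g x _; rewrite addr0.
set C := f x * _; set A := f t * _.
have := IH y; set P := rsum f g y l; set Q := rsum f g y _ => PQ.
have -> : A + P - (B + Q) = (A - C) - (B - C) + (P - Q) by ring.
apply: le_trans (ler_normD _ _) _.
have := ler_normB (A - C) (B - C); lra.
Qed.

Definition small_defects f g a b := forall e, 0 < e -> exists2 d, 0 < d &
  forall ls, chain a (flatten ls) -> chain_end a (flatten ls) <= b ->
    short d a ls -> defects a ls f g <= e.

Lemma small_defects_cauchy f g a b e : a < b -> small_defects f g a b -> 0 < e ->
  exists2 d, 0 < d & forall l1 l2,
    chain a l1 -> chain a l2 -> chain_end a l1 = b -> chain_end a l2 = b ->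
    path <%R a (unzip2 l1) -> path <%R a (unzip2 l2) ->
    short d a (singles l1) -> short d a (singles l2) ->
    `|rsum f g a l1 - rsum f g a l2| <= e.
Proof.
(* Each of the two chains meets the common refinement at the cost of two sums of defects, hence
   [e / 4]. *)
move=> ab sd e0; have [|d d0 dP] := sd (e / 4); first by rewrite divr_gt0.
exists d => // l1 l2 c1 c2 e1 e2 p1 p2 s1 s2.
have R12 := flatten_refineC _ (etrans e1 (esym e2)) p1 p2.
have le l q : chain a l -> chain_end a l = b -> path <%R a (unzip2 l) ->
    short d a (singles l) -> sorted <%R q ->
    `|rsum f g a l - rsum f g a (flatten (refine q a l))| <= e / 2.
  move=> cl el pl sl sq; apply: le_trans (rsum_refine_le _ _ _ _ _) _.
  have := dP (singles l); rewrite flatten_singles el => /(_ cl (lexx _) sl).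
  have := dP (refine q a l); rewrite refine_end el.
  move=> /(_ (chain_refine sq pl) (lexx _) (short_refine _ sl)).
  by lra.
have := le _ _ c1 e1 p1 s1 (path_sorted p2).
have := le _ _ c2 e2 p2 s2 (path_sorted p1).
rewrite R12 ?e1 //; set m := rsum f g a (flatten _).
rewrite !ler_norml; lra.
Qed.

Lemma singles_short d x l :
  (forall i, (i < size l)%N ->
    nth 0 (x :: unzip2 l) i.+1 - nth 0 (x :: unzip2 l) i < d) ->
  short d x (singles l).
Proof.
elim: l x => //= -[t y] l IH x H; split; first exact: (H 0%N).
by apply: IH => i il; apply: (H i.+1).
Qed.

Lemma tagged_partition_chain a b p nu : tagged_partition a b p nu ->
  exists l, [/\ chain a l, chain_end a l = b, path <%R a (unzip2 l),
    forall f g, RS_sum f g p nu = rsum f g a l &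
    forall d, mesh p < d -> short d a (singles l)].
Proof.
case: p => [|x s] [] //= [sn] xa lb ps tg; subst x.
have un : unzip2 (zip nu s) = s by rewrite unzip2_zip ?sn.
exists (zip nu s); rewrite un /chain_end un; split => //.
- elim: nu s a sn {lb ps un} tg => [|t nu IH] [|y s] a //= [sn] tg.
  rewrite (tg 0%N) //=; apply: IH => // i isn; exact: (tg i.+1).
- move=> f g; rewrite /RS_sum; elim: nu s a sn {lb ps un tg} => [|t nu IH] [|y s] a //=.
    by rewrite big_ord0.
  by move=> [sn]; rewrite big_ord_recl /= -IH.
move=> d md; apply: singles_short; rewrite size_zip sn minnn un => i isn.
apply: le_lt_trans md; rewrite /mesh /=.
have isn' : (i < size s)%N by rewrite sn.
exact: (le_bigmax 0 (fun i : 'I_(size s) =>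
  nth 0 (a :: s) i.+1 - nth 0 (a :: s) i) (Ordinal isn')).
Qed.

(** The uniform partition. Its existence bounds the set of eventual lower bounds of the sums, and
    lets estimates on sums pass to the integral. *)
Lemma small_mesh a b d : a < b -> 0 < d ->
  exists p nu, tagged_partition a b p nu /\ mesh p < d.
Proof.
move=> ab d0; have ba0 : 0 < b - a by rewrite subr_gt0.
pose n := (Num.truncn ((b - a) / d)).+1.
have n0 : 0 < n%:R :> R by rewrite ltr0n.
have nd : (b - a) / n%:R < d.
  by rewrite ltr_pdivrMr // mulrC -ltr_pdivrMr // truncnS_gt.
pose F i := a + i%:R * ((b - a) / n%:R).
have FS i : F i.+1 - F i = (b - a) / n%:R by rewrite /F -natr1; ring.
exists (mkseq F n.+1), (mkseq F n); split; last first.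
  rewrite /mesh size_mkseq; elim/big_ind: _ => // [x y xd yd|i _].
    by rewrite gt_max xd.
  have i_n : (i < n)%N := ltn_ord i.
  by rewrite !nth_mkseq ?FS ?ltnS // ltnW.
split; rewrite ?size_mkseq //.
- by rewrite nth_mkseq // /F mul0r addr0.
- rewrite -nth_last size_mkseq -[n.+1.-1]/n nth_mkseq // /F mulrCA divff ?mulr1 ?gt_eqF //.
  by rewrite addrC subrK.
- apply: (homo_sorted (e := ltn)) (iota_ltn_sorted _ _).
  move=> i j ij; rewrite /F ltrD2l ltr_pM2r ?ltr_nat //.
  by rewrite divr_gt0.
- move=> i isn; rewrite !nth_mkseq ?ltnS // 1?ltnW // lexx /=.
  by rewrite -subr_ge0 FS divr_ge0 ?ltW.
Qed.

Lemma small_defects_RS f g a b : a < b -> small_defects f g a b ->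
  exists I, RS_integral f g a b I.
Proof.
move=> ab sd.
(* The supremum of the eventual lower bounds is the lower limit of the sums; the Cauchy property
   makes it their limit. *)
pose E : set R := [set x | exists2 d, 0 < d & forall p nu,
  tagged_partition a b p nu -> mesh p < d -> x <= RS_sum f g p nu].
have cauchy e : 0 < e -> exists2 d, 0 < d & forall p nu p' nu',
    tagged_partition a b p nu -> tagged_partition a b p' nu' ->
    mesh p < d -> mesh p' < d ->
    `|RS_sum f g p nu - RS_sum f g p' nu'| <= e.
  move=> /(small_defects_cauchy ab sd)[d d0 dP]; exists d => // p nu p' nu'.
  move=> /tagged_partition_chain[l [cl el pl -> sl]].
  move=> /tagged_partition_chain[l' [cl' el' pl' -> sl']] /sl {}sl /sl' {}sl'.
  exact: dP.
have mem e d p nu : (forall p' nu', tagged_partition a b p' nu' -> mesh p' < d ->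
    `|RS_sum f g p nu - RS_sum f g p' nu'| <= e) -> 0 < d ->
    E (RS_sum f g p nu - e) /\ ubound E (RS_sum f g p nu + e).
  move=> H d0; split.
    by exists d => // p' nu' t' m'; have := H _ _ t' m'; rewrite ler_norml; lra.
  move=> x [d' d'0 Hx].
  have [|p' [nu' [t' m']]] := @small_mesh a b (Num.min d d') ab.
    by rewrite lt_min d0.
  move: m'; rewrite lt_min => /andP[md md'].
  by have := Hx _ _ t' md'; have := H _ _ t' md; rewrite ler_norml; lra.
exists (sup E) => e e0.
have [|d d0 dP] := cauchy (e / 2); first by rewrite divr_gt0.
exists d => // p nu tp mp.
have [Ep ubE] := mem _ _ _ _ (fun p' nu' t' m' => dP _ _ _ _ tp t' mp m') d0.
have := ub_le_sup (ex_intro _ _ ubE) Ep.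
have := ge_sup (ex_intro _ _ Ep) ubE.
rewrite ltr_norml; lra.
Qed.

End Refinement.

(** * Existence *)

Section Existence.
Context {R : realType}.
Implicit Types (a b c x y z K M e d : R) (f g h u v w : R -> R) (s p q : seq R).
Implicit Types (l : seq (R * R)) (ls : seq (seq (R * R))).

(** On a block where [f] oscillates little, [v] is split off first at weight [e], then [u] at weight
    [theta]; where [g] does, [u] first at weight [e], then [v] at weight [eta]. The stated weights
    cover both cases. *)
Lemma defects_split a b f g u v e eta theta d x ls :
  0 <= e -> 0 <= eta -> 0 <= theta ->
  osc_le a b (f \- u) eta -> osc_le a b (g \- v) theta ->
  (forall x y, a <= x -> y <= b -> y - x < d ->
     osc_le x y f e \/ osc_le x y g e) ->
  a <= x -> chain x (flatten ls) -> chain_end x (flatten ls) <= b ->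
  short d x ls ->
  defects x ls f g <= (e + theta) * tagvar u x ls + (e + eta) * endvar v x ls
    + defects x ls (f \- u) (g \- v).
Proof.
move=> e0 eta0 theta0 fu gv small; elim: ls x => [|l ls IH] x ax /=.
  by rewrite !mulr0 !addr0.
rewrite chain_cat chain_end_cat => /andP[xl ys] zb [xd /IH {}IH].
have xy := chain_end_ge xl; have yz := chain_end_ge ys.
have yb := le_trans yz zb.
have {IH}IH := IH (le_trans ax xy) ys zb.
have fu' := osc_le_sub ax yb fu; have gv' := osc_le_sub ax yb gv.
have U0 := pathvar_ge0 u x (unzip1 l); have V0 := pathvar_ge0 v x (unzip2 l).
have block : `|defect x x l f g| <= (e + theta) * pathvar u x (unzip1 l) +
    (e + eta) * pathvar v x (unzip2 l) + `|defect x x l (f \- u) (g \- v)|.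
  have [fe|ge] := small _ _ ax yb xd.
    have := defect_ends_step g v xl fe.
    have := defect_tags_step f u xl gv'.
    have := mulr_ge0 e0 U0; have := mulr_ge0 eta0 V0.
    by rewrite !mulrDl; lra.
  have := defect_tags_step f u xl ge.
  have := defect_ends_step g v xl fu'.
  have := mulr_ge0 e0 V0; have := mulr_ge0 theta0 U0.
  by rewrite !mulrDl; lra.
rewrite [_ * (_ + tagvar _ _ _)]mulrDr [_ * (_ + endvar _ _ _)]mulrDr; lra.
Qed.

(* The functions [u] and [v] need not respect the continuity points of [f] and [g];
   this is harmless because the order in which they are peeled off is chosen
   block by block. *)
Definition bv_split f g a b e := exists u v eta theta M N,
  [/\ 0 <= eta /\ 0 <= theta,
      osc_le a b (f \- u) eta /\ osc_le a b (g \- v) theta,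
      var_le u a b M /\ var_le v a b N,
      theta * M <= e /\ eta * N <= e &
      forall ls, chain a (flatten ls) -> chain_end a (flatten ls) <= b ->
        defects a ls (f \- u) (g \- v) <= e].

Lemma small_defects_of_split f g a b : a <= b ->
  (forall x, a <= x <= b -> cont_at_in f a b x \/ cont_at_in g a b x) ->
  (forall e, 0 < e -> bv_split f g a b e) -> small_defects f g a b.
Proof.
move=> ab cont split e e0; have e40 : 0 < e / 4 by rewrite divr_gt0.
have [u [v [eta [theta [M [N]]]]]] := split _ e40.
move=> [[eta0 theta0] [fu gv] [uM vN] [thM etN] defe].
have M0 : 0 <= M by apply: (uM a [::]).
have N0 : 0 <= N by apply: (vN a [::]).
have MN0 : 0 < M + N + 1 by lra.
(* Thus [e1 * (M + N) <= e / 4]; the other three quarters go to [theta * M], [eta * N] and the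
   remaining defects. *)
pose e1 := e / 4 / (M + N + 1); have e10 : 0 < e1 by rewrite divr_gt0.
have e1MN : e1 * (M + N + 1) = e / 4 by rewrite /e1 divfK // gt_eqF.
have [d d0 dP] := small_oscillation cont e10.
exists d => // ls al zb sls.
have := defects_split (ltW e10) eta0 theta0 fu gv dP (lexx a) al zb sls.
have := defe _ al zb.
have etheta : 0 <= e1 + theta by lra.
have eeta : 0 <= e1 + eta by lra.
have := ler_wpM2l etheta (tagvar_le uM (lexx a) al zb).
have := ler_wpM2l eeta (endvar_le vN (lexx a) al zb).
rewrite !mulrDl => h1 h2 h3 h4.
move: e1MN; rewrite !mulrDr mulr1; lra.
Qed.

Lemma var_le_of_weight a b f c d e X : 0 < c ->
  (c%:E * TV f a b d <= X%:E)%E -> forall u, pathvar_near_TV a b f u d e ->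
  exists2 M, var_le u a b M & c * M = X + c * e.
Proof.
move=> c0 cX u uTV; exists ((X + c * e) / c); last first.
  by rewrite mulrC divfK // gt_eqF.
move=> x s ax ps lb; rewrite ler_pdivlMr // mulrC.
exact: weighted_le (ltW c0) (TV_ge0 _ _ _ _) cX (uTV _ _ ax ps lb).
Qed.

(** Distance 0 forces [u] to agree with [f] on the interval. *)
Definition bv_on a b f := exists u M, near_on a b f u 0 /\ var_le u a b M.

Lemma bv_on_of_weight a b f c X : 0 < c ->
  (c%:E * TV f a b 0 <= X%:E)%E -> bv_on a b f.
Proof.
move=> c0 cX; have [u [fu uTV]] := TV_approx a b f (lexx 0) ltr01.
by have [M uM _] := var_le_of_weight c0 cX uTV; exists u, M.
Qed.

(** Here [f \- u] vanishes on the interval, hence so do its defects, and [g] is approximated as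
    closely as the variation [M] of [u] requires. *)
Lemma bv_split_l a b f g e : a <= b -> bv_on a b f -> regulated g a b -> 0 < e ->
  bv_split f g a b e.
Proof.
move=> ab [u [M [fu uM]]] gr e0; have M0 : 0 <= M by apply: (uM a [::]).
have d0 : 0 < e / (M + 1) by rewrite divr_gt0 // ltr_wpDl.
have [v bv gv] := regulated_bounded_var ab gr d0.
have [N vN] := bounded_var_le a b bv.
exists u, v, 0, (e / (M + 1)), M, N.
have fu0 := near_on_osc fu; have gvd := near_on_osc gv.
split; rewrite ?(ltW d0) //.
  split; last by rewrite mul0r ltW.
  rewrite mulrAC ler_pdivrMr ?ltr_wpDl // ler_wpM2l ?(ltW e0) //; lra.
move=> ls al zb; apply: le_trans (ltW e0).
by rewrite (le_trans (defects_le_size (lexx 0) fu0 gvd _ al zb)) ?mul0r ?mulr0.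
Qed.

Lemma bv_split_r a b f g e : a <= b -> regulated f a b -> bv_on a b g -> 0 < e ->
  bv_split f g a b e.
Proof.
move=> ab fr [v [N [gv vN]]] e0; have N0 : 0 <= N by apply: (vN a [::]).
have d0 : 0 < e / (N + 1) by rewrite divr_gt0 // ltr_wpDl.
have [u bu fu] := regulated_bounded_var ab fr d0.
have [M uM] := bounded_var_le a b bu.
exists u, v, (e / (N + 1)), 0, M, N.
have gv0 := near_on_osc gv; have fud := near_on_osc fu.
split; rewrite ?(ltW d0) //.
  split; first by rewrite mul0r ltW.
  rewrite mulrAC ler_pdivrMr ?ltr_wpDl // ler_wpM2l ?(ltW e0) //; lra.
move=> ls al zb; apply: le_trans (ltW e0).
by rewrite (le_trans (defects_le_size (ltW d0) fud gv0 _ al zb)) ?mulr0.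
Qed.

Lemma sum_geometric_half d (n m : nat) : 0 <= d ->
  \sum_(m <= k < m + n) d / 2 ^+ k.+1 <= d / 2 ^+ m.
Proof.
move=> d0; suff -> : \sum_(m <= k < m + n) d / 2 ^+ k.+1 =
    d / 2 ^+ m - d / 2 ^+ (m + n) by rewrite gerBl divr_ge0 ?exprn_ge0.
elim: n => [|n IH]; first by rewrite addn0 big_geq // subrr.
rewrite addnS big_nat_recr ?leq_addr //= IH.
have p : 2 ^+ (m + n) != 0 :> R by rewrite expf_neq0 // pnatr_eq0.
by rewrite [2 ^+ (m + n).+1]exprS; field; rewrite p expf_neq0 // pnatr_eq0.
Qed.

Lemma nonincreasing_le0 (F : nat -> R) : (forall k, F k.+1 <= F k) ->
  forall k, F k <= F 0%N.
Proof. by move=> FS; elim=> // k; apply: le_trans (FS k). Qed.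

(** The number of tags is fixed before [n], so the leftover of [defects_telescope] vanishes as [n]
    grows: [theta] tends to 0 while [eta] stays below [eta 0]. The errors [d / 2 ^+ k.+1] sum to at
    most [d]. *)
Lemma defects_tail a b f g (eta theta X Y : nat -> R) d tau m u v x ls :
  (forall k, 0 <= eta k) -> (forall k, eta k.+1 <= eta k) ->
  (forall k, 0 <= theta k) -> (forall k, theta k.+1 <= theta k) ->
  theta @ \oo --> 0 ->
  (forall k, ((theta k)%:E * TV f a b (eta k.+1) <= (X k)%:E)%E) ->
  (forall k, ((eta k.+1)%:E * TV g a b (theta k.+1) <= (Y k)%:E)%E) ->
  0 < d ->
  (forall n, \sum_(m <= k < m + n) (2 * X k + 2 * Y k) <= tau) ->
  near_on a b f u (eta m) -> pathvar_near_TV a b f u (eta m) (d / 2 ^+ m.+1) ->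
  near_on a b g v (theta m) ->
  pathvar_near_TV a b g v (theta m) (d / 2 ^+ m.+1) ->
  a <= x -> chain x (flatten ls) -> chain_end x (flatten ls) <= b ->
  defects x ls (f \- u) (g \- v) <= tau + 2 * (theta 0%N + eta 0%N) * d.
Proof.
move=> eta0 etaS theta0 thetaS thetacv XP YP d0 tauP fu uTV gv vTV ax xl zb.
have er0 k : 0 < d / 2 ^+ k.+1 by rewrite divr_gt0 // exprn_gt0.
have erS k : d / 2 ^+ k.+2 <= d / 2 ^+ k.+1.
  rewrite ler_wpM2l ?(ltW d0) // lef_pV2 ?posrE ?exprn_gt0 //.
  by rewrite [leRHS]exprS ler_peMl ?exprn_ge0 //; lra.
apply/ler_addgt0Pr => e e0.
set cnt := (size (flatten ls))%:R : R; have cnt0 : 0 <= cnt by [].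
have c0 : 0 < cnt * eta 0%N + 1 by rewrite ltr_wpDl // mulr_ge0.
have e10 : 0 < e / (cnt * eta 0%N + 1) by rewrite divr_gt0.
have /cvgrPdist_le/(_ _ e10)[n _ nP] := thetacv.
have := defects_telescope eta0 etaS theta0 thetaS XP YP er0 erS
  n fu uTV gv vTV ax xl zb.
rewrite big_split /= => /le_trans; apply.
have := nP (m + n)%N (leq_addl _ _); rewrite sub0r normrN ger0_norm // => thn.
have last_le : cnt * (eta (m + n)%N * theta (m + n)%N) <= e.
  rewrite mulrA; apply: le_trans (_ : (cnt * eta 0%N) * theta (m + n)%N <= _).
    by rewrite ler_wpM2r // ler_wpM2l // nonincreasing_le0.
  apply: le_trans (ler_wpM2l _ thn) _; first by rewrite mulr_ge0.
  by rewrite mulrCA ler_piMr ?(ltW e0) // ler_pdivrMr // mul1r lerDl.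
have mid_le : \sum_(m <= k < m + n)
    2 * (theta k + eta k.+1) * (d / 2 ^+ k.+1) <=
    2 * (theta 0%N + eta 0%N) * d.
  apply: (@le_trans _ _ (\sum_(m <= k < m + n)
      2 * (theta 0%N + eta 0%N) * (d / 2 ^+ k.+1))).
    apply: ler_sum => k _; rewrite ler_wpM2r ?(ltW (er0 k)) // ler_wpM2l //.
    by rewrite lerD ?nonincreasing_le0.
  rewrite -mulr_sumr ler_wpM2l ?mulr_ge0 ?addr_ge0 //.
  apply: le_trans (sum_geometric_half n m (ltW d0)) _.
  rewrite ler_pdivrMr ?exprn_gt0 // ler_peMr ?(ltW d0) //.
  by rewrite exprn_ege1 //; lra.
by have := tauP n; lra.
Qed.

End Existence.

(** * The bound *)

Section Main.
Context {R : realType}.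
Implicit Types (a b : R) (f g : R -> R).

Lemma nneseriesD_finite (A B : nat -> \bar R) :
  (forall k, (0 <= A k)%E) -> (forall k, (0 <= B k)%E) ->
  (\sum_(0 <= k <oo) A k + \sum_(0 <= k <oo) B k < +oo)%E ->
  exists X Y : nat -> R, [/\ forall k, A k = (X k)%:E, forall k, B k = (Y k)%:E &
    forall n, ((\sum_(0 <= k < n) (X k + Y k))%:E <=
      \sum_(0 <= k <oo) A k + \sum_(0 <= k <oo) B k)%E].
Proof.
move=> A0 B0 fin.
have SA0 : (0 <= \sum_(0 <= k <oo) A k)%E by apply: nneseries_ge0.
have SB0 : (0 <= \sum_(0 <= k <oo) B k)%E by apply: nneseries_ge0.
have term (C : nat -> \bar R) k : (forall k, (0 <= C k)%E) ->
    (\sum_(0 <= k <oo) C k < +oo)%E -> C k = (fine (C k))%:E.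
  move=> C0 Cfin; rewrite fineK // ge0_fin_numE //; apply: le_lt_trans Cfin.
  apply: le_trans (nneseries_lim_ge k.+1 (fun n _ _ => C0 n)).
  by rewrite big_nat_recr //= leeDr // sume_ge0.
have Ak k := term A k A0 (le_lt_trans (leeDl _ SB0) fin).
have Bk k := term B k B0 (le_lt_trans (leeDr _ SA0) fin).
exists (fine \o A), (fine \o B); split => // n /=.
rewrite big_split EFinD -!sumEFin /=.
rewrite (eq_bigr A) => [|k _]; last by rewrite -Ak.
rewrite (eq_bigr B (F1 := fun k => (fine (B k))%:E)) => [|k _]; last by rewrite -Bk.
by rewrite leeD ?nneseries_lim_ge.
Qed.

(* The factor [2 ^+ k.+1 >= 2] absorbs the two approximants whose difference is
   taken at each telescoping step. *)
Lemma half_weight (k : nat) (t X : R) (T : \bar R) : 0 <= t -> (0 <= T)%E ->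
  ((2 ^+ k.+1)%:E * t%:E * T = X%:E)%E -> (t%:E * T <= (X / 2)%:E)%E.
Proof.
move=> t0 T0 XE; have -> : (X / 2)%:E = ((2 ^+ k * t)%:E * T)%E.
  rewrite mulrC EFinM -XE !muleA -!EFinM; congr (_%:E * _)%E.
  by rewrite exprS !mulrA mulVf ?mul1r // pnatr_eq0.
rewrite lee_pmul ?lee_fin //; apply: ler_peMl => //.
by rewrite exprn_ege1 //; lra.
Qed.

Lemma theta_prev0 a b g (theta : nat -> R) : a <= b -> regulated g a b ->
  exists t : R, [/\ theta_prev g a b theta 0 = t%:E, 0 <= t &
    forall y, a <= y <= b -> `|g b - g y| <= t].
Proof.
move=> ab gr; have [K gK] := regulated_osc ab gr.
have ub y : a <= y <= b -> ((`|g b - g y|)%:E <= theta_prev g a b theta 0)%E.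
  by move=> ay; apply: ereal_sup_ubound; exists y.
have tp0 : (0 <= theta_prev g a b theta 0)%E.
  by apply: le_trans (ub b _); rewrite ?ab ?lexx // lee_fin.
have tpK : (theta_prev g a b theta 0 <= K%:E)%E.
  by apply: ge_ereal_sup => _ [y ay <-]; rewrite lee_fin gK // ab lexx.
have tpE : theta_prev g a b theta 0 = (fine (theta_prev g a b theta 0))%:E.
  by rewrite fineK // ge0_fin_numE // (le_lt_trans tpK) ?ltry.
exists (fine (theta_prev g a b theta 0)); split => // [|y /ub].
  exact: fine_ge0.
by rewrite {1}tpE lee_fin.
Qed.

(** The terms of index 0 have weight 1 and are spent undoubled; later terms are also recorded in
    halves, to pay for the factor 2 in telescoping. *)
Lemma S_tilde_finite a b f g (eta theta : nat -> R) :
  a <= b -> regulated g a b -> (forall k, 0 <= eta k) ->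
  (forall k, 0 <= theta k) -> (S_tilde f g a b eta theta < +oo)%E ->
  exists (t : R) (X Y : nat -> R) (S : R),
  [/\ 0 <= t /\ (forall y, a <= y <= b -> `|g b - g y| <= t),
      (t%:E * TV f a b (eta 0%N) <= (X 0%N)%:E)%E /\
      (forall k, ((theta k)%:E * TV f a b (eta k.+1) <= (X k.+1 / 2)%:E)%E),
      (forall k, ((eta k)%:E * TV g a b (theta k) <= (Y k)%:E)%E) /\
      (forall k, ((eta k.+1)%:E * TV g a b (theta k.+1) <= (Y k.+1 / 2)%:E)%E),
      (forall k, 0 <= X k) /\ (forall k, 0 <= Y k) &
      S_tilde f g a b eta theta = S%:E /\
      (forall n, \sum_(0 <= k < n) (X k + Y k) <= S)].
Proof.
move=> ab gr eta0 theta0 fin.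
have [t [tE t0 gt]] := theta_prev0 theta ab gr.
have A0 k : (0 <= (2 ^+ k)%:E * theta_prev g a b theta k * TV f a b (eta k))%E.
  rewrite mule_ge0 ?TV_ge0 // mule_ge0 ?lee_fin ?exprn_ge0 //.
  by case: k => [|k]; rewrite ?tE lee_fin.
have B0 k : (0 <= (2 ^+ k * eta k)%:E * TV g a b (theta k))%E.
  by rewrite mule_ge0 ?TV_ge0 // lee_fin mulr_ge0 ?exprn_ge0.
have [X [Y [XE YE XY]]] := nneseriesD_finite A0 B0 fin.
have S0 : (0 <= S_tilde f g a b eta theta)%E.
  by rewrite adde_ge0 // nneseries_ge0.
exists t, X, Y, (fine (S_tilde f g a b eta theta)).
have SE : S_tilde f g a b eta theta = (fine (S_tilde f g a b eta theta))%:E.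
  by rewrite fineK // ge0_fin_numE.
split => //.
- split; first by rewrite -XE expr0 mul1e tE.
  by move=> k; apply: (half_weight (k := k)) (XE k.+1); rewrite ?TV_ge0.
- split=> k.
    rewrite -YE lee_pmul ?lee_fin ?TV_ge0 // ler_peMl //.
    by rewrite exprn_ege1 //; lra.
  by apply: (half_weight (k := k)); rewrite ?TV_ge0 // -EFinM YE.
- by split=> k; rewrite -lee_fin -?XE -?YE.
- by split=> // n; rewrite -lee_fin -SE; apply: XY.
Qed.

(** In the order [t], [eta 0], [theta 0], [eta 1], [theta 1], ..., a zero preceded by a positive
    entry makes an untruncated variation finite, that entry being its weight. If [t] and [eta 0]
    both vanish, [g] is constant on the interval. *)
Lemma bv_on_of_zero a b f g (eta theta X Y : nat -> R) (t x y : R) :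
  0 <= t -> (forall y, a <= y <= b -> `|g b - g y| <= t) ->
  (forall k, 0 <= eta k) -> (forall k, 0 <= theta k) ->
  (t%:E * TV f a b (eta 0%N) <= x%:E)%E ->
  (forall k, ((theta k)%:E * TV f a b (eta k.+1) <= (X k)%:E)%E) ->
  ((eta 0%N)%:E * TV g a b (theta 0%N) <= y%:E)%E ->
  (forall k, ((eta k.+1)%:E * TV g a b (theta k.+1) <= (Y k)%:E)%E) ->
  forall k, eta k = 0 \/ theta k = 0 -> bv_on a b f \/ bv_on a b g.
Proof.
move=> t0 gt eta0 theta0 X0 XP Y0 YP; elim=> [|k IH].
  have [e00 _|e0] := eqVneq (eta 0%N) 0; last first.
    case=> [/eqP|th0]; first by rewrite (negPf e0).
    right; rewrite th0 in Y0; apply: bv_on_of_weight Y0.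
    by rewrite lt_def e0 eta0.
  have [tE|tn0] := eqVneq t 0; last first.
    by left; rewrite e00 in X0; apply: bv_on_of_weight X0; rewrite lt_def tn0.
  right; exists (fun=> g b), 0; split.
    by move=> z /gt; rewrite tE mul0r distrC.
  move=> z s _ _ _; elim: s z => //= w s IH z.
  by rewrite subrr normr0 add0r.
have [e0|e0] := eqVneq (eta k) 0; first by move=> _; apply: IH; left.
have [h0|h0] := eqVneq (theta k) 0; first by move=> _; apply: IH; right.
have hp : 0 < theta k by rewrite lt_def h0 theta0.
have [e10 _|e1] := eqVneq (eta k.+1) 0.
  by left; have := XP k; rewrite e10; apply: bv_on_of_weight.
case=> [/eqP|h1]; first by rewrite (negPf e1).
right; have := YP k; rewrite h1; apply: bv_on_of_weight.
by rewrite lt_def e1 eta0.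
Qed.

Lemma bounded_tail (F : nat -> R) (S e : R) : (forall k, 0 <= F k) ->
  (forall n, \sum_(0 <= k < n) F k <= S) -> 0 < e ->
  exists N, forall m n : nat, (N <= m)%N -> (m <= n)%N ->
    \sum_(m <= k < n) F k <= e.
Proof.
move=> F0 FS e0; pose E := [set \sum_(0 <= k < n) F k | n in setT].
have supE : has_sup E.
  by split; [exists (\sum_(0 <= k < 0) F k), 0%N|exists S => _ [n _ <-]].
have [_ [N _ <-] supN] := sup_adherent e0 supE.
exists N => m n Nm mn.
have mono : \sum_(0 <= k < N) F k <= \sum_(0 <= k < m) F k.
  by rewrite (@big_cat_nat _ _ _ N 0 m) //= lerDl sumr_ge0.
have : \sum_(0 <= k < n) F k <= sup E.
  by apply: ub_le_sup; [case: supE|exists n].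
by rewrite (@big_cat_nat _ _ _ m 0 n) //=; lra.
Qed.

End Main.

Unset Implicit Arguments.

Theorem theorem2 (R : realType) (a b : R) (f g : R -> R) (eta theta : nat -> R) :
  a < b ->
  regulated f a b -> regulated g a b ->
  (forall x, a <= x <= b -> cont_at_in f a b x \/ cont_at_in g a b x) ->
  (forall k, 0 <= eta k) -> (forall k, eta k.+1 <= eta k) -> eta @ \oo --> 0 ->
  (forall k, 0 <= theta k) -> (forall k, theta k.+1 <= theta k) -> theta @ \oo --> 0 ->
  (S_tilde f g a b eta theta < +oo)%E ->
  exists I : R, RS_integral f g a b I /\
    ((`|I - f a * (g b - g a)|)%:E <= S_tilde f g a b eta theta)%E.
Proof.
move=> ab fr gr cont eta0 etaS _ theta0 thetaS thetacv fin.
have leab := ltW ab.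
have [t [X [Y [S [[t0 gt] [X0 XP] [Y0 YP] [Xge0 Yge0] [-> XYS]]]]]] :=
  S_tilde_finite leab gr eta0 theta0 fin.
have halves m n : \sum_(m <= k < n) (2 * (X k.+1 / 2) + 2 * (Y k.+1 / 2)) =
    \sum_(m.+1 <= k < n.+1) (X k + Y k).
  by rewrite big_add1; apply: eq_bigr => k _; field.
have XY0 k : 0 <= X k + Y k by rewrite addr_ge0.
have C0 : 0 <= 2 * (theta 0%N + eta 0%N) by rewrite mulr_ge0 ?addr_ge0.
have [I fgI] : exists I, RS_integral f g a b I.
  apply: small_defects_RS => //; apply: small_defects_of_split => // e e0.
  (* A zero weight would not bound the variation of the approximants, so this case goes through
     bounded variation instead. *)
  have [[k zk]|nz] := pselect (exists k, eta k = 0 \/ theta k = 0).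
    have [bf|bg] := bv_on_of_zero t0 gt eta0 theta0 X0 XP (Y0 0%N) YP zk.
      exact: bv_split_l.
    exact: bv_split_r.
  have etap k : 0 < eta k.
    by rewrite lt_def eta0 andbT; apply/eqP => ek; apply: nz; exists k; left.
  have thetap k : 0 < theta k.
    by rewrite lt_def theta0 andbT; apply/eqP => ek; apply: nz; exists k; right.
  have e20 : 0 < e / 2 by rewrite divr_gt0.
  have [N tail] := bounded_tail XY0 XYS e20.
  (* [D] dominates the coefficient of [d] in [defects_tail] and every [eta k] and [theta k]. *)
  pose D := 2 * (theta 0%N + eta 0%N) + 1.
  have D0 : 0 < D by rewrite ltr_wpDl.
  pose d := e / 2 / D; have d0 : 0 < d by rewrite divr_gt0.
  have dD : d * D = e / 2 by rewrite /d divfK // gt_eqF.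
  have er0 : 0 < d / 2 ^+ N.+1 by rewrite divr_gt0 // exprn_gt0.
  have erd : d / 2 ^+ N.+1 <= d.
    rewrite ler_pdivrMr ?exprn_gt0 // ler_peMr ?(ltW d0) //.
    by rewrite exprn_ege1 //; lra.
  have [u [fu uTV]] := TV_approx a b f (eta0 N) er0.
  have [v [gv vTV]] := TV_approx a b g (theta0 N) er0.
  have TVN : ((theta N)%:E * TV f a b (eta N) <= (X N.+1 / 2)%:E)%E.
    by apply: le_trans (XP N); rewrite lee_pmul ?lee_fin ?TV_ge0 ?TV_le.
  have [M uM thM] := var_le_of_weight (thetap N) TVN uTV.
  have [M' vM' etM'] := var_le_of_weight (etap N) (Y0 N) vTV.
  have dC k : theta k * (d / 2 ^+ N.+1) <= e / 2 /\ eta k * (d / 2 ^+ N.+1) <= e / 2.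
    have h1 := nonincreasing_le0 thetaS k; have h2 := nonincreasing_le0 etaS k.
    have th00 := theta0 0%N; have et00 := eta0 0%N.
    rewrite -dD; split; apply: le_trans (ler_wpM2l _ erd) _ => //.
      by rewrite mulrC ler_wpM2l ?(ltW d0) // /D; lra.
    by rewrite mulrC ler_wpM2l ?(ltW d0) // /D; lra.
  have XYN k : (N <= k)%N -> X k <= e / 2 /\ Y k <= e / 2.
    move=> Nk; have := tail k k.+1 Nk (leqnSn k).
    by rewrite big_nat1; have := Xge0 k; have := Yge0 k; split; lra.
  exists u, v, (eta N), (theta N), M, M'; split => //.
  - by split; apply: near_on_osc.
  - rewrite thM etM'; have [h1 h2] := dC N; have [h3 _] := XYN N.+1 (leqnSn N).
    by have [_ h4] := XYN N (leqnn N); have := Xge0 N.+1; split; lra.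
  move=> ls al zb.
  have tailN n : \sum_(N <= k < N + n) (2 * (X k.+1 / 2) + 2 * (Y k.+1 / 2)) <= e / 2.
    by rewrite halves tail // ltnS leq_addr.
  have := defects_tail eta0 etaS theta0 thetaS thetacv XP YP d0 tailN fu uTV gv vTV
    (lexx a) al zb.
  move/le_trans; apply.
  by move: dD; rewrite mulrC /D mulrDl mul1r; lra.
exists I; split => //; rewrite lee_fin.
have bound p nu : tagged_partition a b p nu ->
    `|RS_sum f g p nu - f a * (g b - g a)| <= S.
  move=> /tagged_partition_chain[l [al lb _ -> _]].
  (* The coefficients of [d] in three errors: the tail, splitting off [u] at weight [t], and
     splitting off [v] at weight [eta 0]. *)
  pose D := 2 * (theta 0%N + eta 0%N) + t + eta 0%N + 1.
  have D0 : 0 < D by have := eta0 0%N; rewrite /D; lra.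
  apply/ler_addgt0Pr => e e0; pose d := e / D.
  have d0 : 0 < d by rewrite divr_gt0.
  have dD : D * d = e by rewrite mulrC /d divfK // gt_eqF.
  have er0 : 0 < d / 2 ^+ 1 by rewrite divr_gt0.
  have [u [fu uTV]] := TV_approx a b f (eta0 0%N) er0.
  have [v [gv vTV]] := TV_approx a b g (theta0 0%N) er0.
  have [s [ps ls us]] : exists s, [/\ path <=%R a s, last a s <= b &
      t * pathvar u a (unzip1 l) <= t * pathvar u a s].
    exists (unzip1 l); have [? lel] := chain_path_tags (lexx a) al.
    by split; rewrite // -lb.
  have up := weighted_le t0 (TV_ge0 _ _ _ _) X0 (uTV _ _ (lexx a) ps ls).
  have lb' : last a (unzip2 l) <= b by rewrite -lb.
  have vp := weighted_le (eta0 0%N) (TV_ge0 _ _ _ _) (Y0 0%N)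
    (vTV _ _ (lexx a) (chain_path_ends al) lb').
  (* The whole partition is one block. Summation by parts only meets differences [g b - g y], so [t]
     suffices in place of the oscillation of [g]. *)
  have step1 : `|defect a a l f g| <=
      t * pathvar u a (unzip1 l) + `|defect a a l (f \- u) g|.
    have : `|defect a a l u g| <= t * pathvar u a (unzip1 l).
      by apply: defect_le_tags => // y; rewrite lb; apply: gt.
    rewrite defectBl.
    have := ler_normD (defect a a l f g - defect a a l u g) (defect a a l u g).
    by rewrite subrK; lra.
  have step2 : `|defect a a l (f \- u) g| <= eta 0%N * pathvar v a (unzip2 l)
      + `|defect a a l (f \- u) (g \- v)|.
    by apply: defect_ends_step => //; rewrite lb; apply: near_on_osc.
  (* [X 0] and [Y 0] pay for splitting off [u] and [v]; the rest of [S] pays for the telescoping. *)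
  have tail n : \sum_(0 <= k < 0 + n) (2 * (X k.+1 / 2) + 2 * (Y k.+1 / 2)) <=
      S - X 0%N - Y 0%N.
    rewrite halves; have := XYS n.+1; rewrite big_ltn //; lra.
  have := defects_tail eta0 etaS theta0 thetaS thetacv XP YP d0 tail fu uTV gv vTV
    (lexx a) (ls := [:: l]).
  rewrite /= cats0 addr0 => /(_ al); rewrite lb => /(_ (lexx b)).
  move: step1 step2; rewrite {1}/defect lb.
  have td : t * (d / 2 ^+ 1) <= t * d.
    by rewrite ler_wpM2l // ler_pdivrMr // expr1 mulr_natr mulr2n lerDl ltW.
  have ed : eta 0%N * (d / 2 ^+ 1) <= eta 0%N * d.
    by rewrite ler_wpM2l // ler_pdivrMr // expr1 mulr_natr mulr2n lerDl ltW.
  move: dD; rewrite {1}/D 3!mulrDl mul1r; lra.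
(* The bound on sums passes to [I] through one partition of small mesh. *)
apply/ler_addgt0Pr => e e0; have [d d0 dP] := fgI e e0.
have [p [nu [tp mp]]] := small_mesh ab d0.
have := dP p nu tp mp; have := bound p nu tp.
rewrite !ler_norml !ltr_norml; lra.
Qed.
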